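(* (In simplicial type theory.) Let $A$ be a pre-$\infty$-category (Segal type) and let $C : A \to \mathcal{U}$ be a covariant family over $A$. Then, for any $a : A$, the map \[ \mathsf{evid}_{A,a,C} : \Big( \prod_{z:A} \hom_A(a,z) \to C(z) \Big) \to C(a) \] defined by \[ \mathsf{evid}_{A,a,C}(\varphi) :\equiv \varphi(a,\mathrm{id}_a) \] is an equivalence.
   Context: **Ambient theory.** The theorem is a statement inside simplicial type theory (Riehl–Shulman), an extension of intensional Martin-Löf type theory with $\Sigma$-, $\Pi$- (judgmental $\beta,\eta$) and identity types $x =_A y$. Type families are written $C : A \to \mathcal{U}$. Univalence is not assumed. Usual homotopy type theory notions: $\mathsf{isContr}(X) :\equiv \sum_{x:X}\prod_{y:X}(x=y)$; a map $f:X\to Y$ is an equivalence if $\mathsf{isEquiv}(f) :\equiv \big(\sum_{g:Y\to X} g\circ f = \mathrm{id}_X\big)\times\big(\sum_{h:Y\to X} f\circ h=\mathrm{id}_Y\big)$ is inhabited. **Cubes, topes, shapes.** There is a cube $\mathbf{2}$ (directed interval) with points $0,1:\mathbf 2$ and a relation (tope) $x\le y$ which is a total order on $\mathbf 2$ with distinct bottom $0$ and top $1$; cubes are the finite powers $\mathbf 2^n$. Topes are formulas of a finitary intuitionistic logic over cube variables (built from $\top,\bot,\wedge,\vee,\equiv,\le$). A shape is $\{t:I\mid\varphi\}$ for a cube $I$ and tope $\varphi$. In particular $\Delta^1 :\equiv\{t:\mathbf 2\mid\top\}$, $\partial\Delta^1:\equiv\{t:\mathbf 2\mid (t\equiv 0)\vee(t\equiv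 1)\}$, $\Delta^2:\equiv\{(t,s):\mathbf 2^2\mid s\le t\}$, $\partial\Delta^2:\equiv\{(t,s):\mathbf 2^2\mid (s\equiv 0)\vee(s\equiv t)\vee(t\equiv 1)\}$. Types and terms may depend on cube variables and tope assumptions. **Extension types.** For a shape inclusion $\Phi\subseteq\Psi$, a family $A$ over $\Psi$, and a partial section $a:\prod_{t:\Phi}A(t)$, the extension type $\left\langle \prod_{t:\Psi}A(t)\,\middle|^{\Phi}_{a}\right\rangle$ consists of sections $b$ of $A$ over $\Psi$ that agree judgmentally with $a$ on $\Phi$; it is written $\langle\Psi\to A|^\Phi_a\rangle$ when $A$ is constant. **Standing axioms.** Function extensionality: for $f,g:\prod_{x:X}A(x)$ the canonical map $(f=g)\to\prod_{x:X}(f x=g x)$ is an equivalence. Extension extensionality: for $f,g:\left\langle \prod_{t:\Psi}A(t)\,\middle|^{\Phi}_{a}\right\rangle$ the canonical map $(f=g)\to\left\langle\prod_{t:\Psi}(f(t)=g(t))\,\middle|^{\Phi}_{\mathrm{refl}}\right\rangle$ is an equivalence. **Hom types.** For $a,b:A$, $\hom_A(a,b):\equiv\langle\Delta^1\to A|^{\partial\Delta^1}_{[a,b]}\rangle$, where $[a,b](0)\equiv a$, $[a,b](1)\equiv b$. The identity arrow is $\mathrm{id}_x:\equiv\lambda s.x:\hom_A(x,x)$. For $f:\hom_A(x,y)$, $g:\hom_A(y,z)$, $h:\hom_A(x,z)$, $\hom_A^2(f,g;h):\equiv\langle\Delta^2\to A|^{\partial\Delta^2}_{[f,g;h]}\rangle$,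 the type of $2$-simplices whose boundary is $f$ on $s\equiv0$ (value $f(t)$), $g$ on $t\equiv1$ (value $g(s)$), and $h$ on $s\equiv t$ (value $h(t)$). **Pre-$\infty$-category (Segal type).** A type $A$ such that for all $x,y,z:A$, $f:\hom_A(x,y)$, $g:\hom_A(y,z)$, the type $\sum_{h:\hom_A(x,z)}\hom_A^2(f,g;h)$ is contractible. **Covariant family.** For $C:A\to\mathcal U$, $f:\hom_A(x,y)$, $u:C(x)$, $v:C(y)$, let $\mathrm{dhom}_{C(f)}(u,v):\equiv\left\langle\prod_{t:\Delta^1}C(f(t))\,\middle|^{\partial\Delta^1}_{[u,v]}\right\rangle$. The family $C$ is covariant if for all $x,y:A$, $f:\hom_A(x,y)$, $u:C(x)$, the type $\sum_{v:C(y)}\mathrm{dhom}_{C(f)}(u,v)$ is contractible. *)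

(* Defs.v *)
From mathcomp Require Import all_boot.

Set Implicit Arguments.
Unset Strict Implicit.
Unset Printing Implicit Defensive.

(* A deep embedding of simplicial type theory: raw syntax with de Bruijn
   indices, and inductively defined typing and judgmental equality.  There are
   two independent name spaces of indices: [IVar] for interval variables and
   [Var] for type-theoretic variables.  A theorem of simplicial type theory is a
   closed type that is inhabited in the empty context.    *)

(* The only cubes are the powers 2^n, so a cube context is a number n of
   interval variables, and a point of 2^k is a sequence of k interval terms. *)
Inductive ival : Type := I0 | I1 | IVar of nat.

Inductive tope : Type :=
| TTop | TBot
| TAnd of tope & tope
| TOr of tope & tope
| TEq of ival & ival
| TLe of ival & ival.

Definition ival_wf (n : nat) (x : ival) : bool :=
  if x is IVar i then i < n else true.

Fixpoint tope_wf (n : nat) (phi : tope) : bool :=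
  match phi with
  | TTop | TBot => true
  | TAnd p q | TOr p q => tope_wf n p && tope_wf n q
  | TEq x y | TLe x y => ival_wf n x && ival_wf n y
  end.

Definition ival_subst (r : nat -> ival) (x : ival) : ival :=
  if x is IVar i then r i else x.

Fixpoint tope_subst (r : nat -> ival) (phi : tope) : tope :=
  match phi with
  | TTop => TTop
  | TBot => TBot
  | TAnd p q => TAnd (tope_subst r p) (tope_subst r q)
  | TOr p q => TOr (tope_subst r p) (tope_subst r q)
  | TEq x y => TEq (ival_subst r x) (ival_subst r y)
  | TLe x y => TLe (ival_subst r x) (ival_subst r y)
  end.

(* A binder of a point of 2^k binds k interval variables at once, and index
   i < k is the i-th coordinate (so the coordinates (t, s) of a point of 2^2 are
   [IVar 0] and [IVar 1]); indices >= k refer to the ambient variables. *)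
Definition ishift (k : nat) : nat -> ival := fun i => IVar (k + i).

Definition iup (k : nat) (r : nat -> ival) : nat -> ival := fun i =>
  if i < k then IVar i else ival_subst (ishift k) (r (i - k)).

Definition inst (p : seq ival) : nat -> ival := fun i =>
  if i < size p then nth I0 p i else IVar (i - size p).

Definition ivars (k : nat) : seq ival := [seq IVar i | i <- iota 0 k].

Inductive entails (n : nat) : seq tope -> tope -> Prop :=
| ent_hyp Phi k : k < size Phi -> entails n Phi (nth TTop Phi k)
| ent_top Phi : entails n Phi TTop
| ent_bot Phi phi : tope_wf n phi -> entails n Phi TBot -> entails n Phi phi
| ent_and Phi p q :
    entails n Phi p -> entails n Phi q -> entails n Phi (TAnd p q)
| ent_andl Phi p q : entails n Phi (TAnd p q) -> entails n Phi p
| ent_andr Phi p q : entails n Phi (TAnd p q) -> entails n Phi q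
| ent_orl Phi p q : tope_wf n q -> entails n Phi p -> entails n Phi (TOr p q)
| ent_orr Phi p q : tope_wf n p -> entails n Phi q -> entails n Phi (TOr p q)
| ent_or Phi p q phi :
    entails n Phi (TOr p q) ->
    entails n (p :: Phi) phi -> entails n (q :: Phi) phi -> entails n Phi phi
| ent_eq_refl Phi x : ival_wf n x -> entails n Phi (TEq x x)
| ent_eq_sym Phi x y : entails n Phi (TEq x y) -> entails n Phi (TEq y x)
| ent_eq_trans Phi x y z :
    entails n Phi (TEq x y) -> entails n Phi (TEq y z) -> entails n Phi (TEq x z)
| ent_le_eq Phi x y : entails n Phi (TEq x y) -> entails n Phi (TLe x y)
| ent_le_trans Phi x y z :
    entails n Phi (TLe x y) -> entails n Phi (TLe y z) -> entails n Phi (TLe x z)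
| ent_le_anti Phi x y :
    entails n Phi (TLe x y) -> entails n Phi (TLe y x) -> entails n Phi (TEq x y)
| ent_le_total Phi x y :
    ival_wf n x -> ival_wf n y -> entails n Phi (TOr (TLe x y) (TLe y x))
| ent_le0 Phi x : ival_wf n x -> entails n Phi (TLe I0 x)
| ent_le1 Phi x : ival_wf n x -> entails n Phi (TLe x I1)
| ent_neq01 Phi : entails n Phi (TEq I0 I1) -> entails n Phi TBot.

(* [Pi], [Sig] and [Lam] bind one variable in their last argument.
   [J C d p] is based identity elimination; [C] binds the other endpoint (index
   1) and the identification (index 0).
   [Ext k psi phi A a] is the extension type < prod_(t : psi) A(t) |^phi_a > over
   the shape inclusion {t : 2^k | phi} <= {t : 2^k | psi}; [A] and [a] bind the
   point t.  Shapes are closed: psi and phi only mention the k bound variables.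
   [RecBot] and [RecOr] are the eliminators of absurd and disjunctive topes.
   [FunExt] and [ExtExt] are the two extensionality axioms. *)
Inductive tm : Type :=
| Var of nat
| U of nat
| Pi of tm & tm
| Lam of tm
| App of tm & tm
| Sig of tm & tm
| Pair of tm & tm
| Fst of tm
| Snd of tm
| Id of tm & tm & tm
| Refl of tm
| J of tm & tm & tm
| Ext of nat & tope & tope & tm & tm
| ELam of nat & tm
| EApp of tm & seq ival
| RecBot
| RecOr of tope & tope & tm & tm
| FunExt of nat & nat
| ExtExt of nat & nat & tope & tope.

Fixpoint isubst (r : nat -> ival) (t : tm) : tm :=
  match t with
  | Var _ | U _ | RecBot | FunExt _ _ | ExtExt _ _ _ _ => t
  | Pi A B => Pi (isubst r A) (isubst r B)
  | Lam b => Lam (isubst r b)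
  | App f a => App (isubst r f) (isubst r a)
  | Sig A B => Sig (isubst r A) (isubst r B)
  | Pair a b => Pair (isubst r a) (isubst r b)
  | Fst p => Fst (isubst r p)
  | Snd p => Snd (isubst r p)
  | Id A a b => Id (isubst r A) (isubst r a) (isubst r b)
  | Refl a => Refl (isubst r a)
  | J C d p => J (isubst r C) (isubst r d) (isubst r p)
  | Ext k psi phi A a =>
      Ext k psi phi (isubst (iup k r) A) (isubst (iup k r) a)
  | ELam k b => ELam k (isubst (iup k r) b)
  | EApp f p => EApp (isubst r f) [seq ival_subst r x | x <- p]
  | RecOr phi psi a b =>
      RecOr (tope_subst r phi) (tope_subst r psi) (isubst r a) (isubst r b)
  end.

Definition iwk (k : nat) : tm -> tm := isubst (ishift k).

Definition rup (r : nat -> nat) : nat -> nat := fun i =>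
  if i is j.+1 then (r j).+1 else 0.

Fixpoint ren (r : nat -> nat) (t : tm) : tm :=
  match t with
  | Var i => Var (r i)
  | U _ | RecBot | FunExt _ _ | ExtExt _ _ _ _ => t
  | Pi A B => Pi (ren r A) (ren (rup r) B)
  | Lam b => Lam (ren (rup r) b)
  | App f a => App (ren r f) (ren r a)
  | Sig A B => Sig (ren r A) (ren (rup r) B)
  | Pair a b => Pair (ren r a) (ren r b)
  | Fst p => Fst (ren r p)
  | Snd p => Snd (ren r p)
  | Id A a b => Id (ren r A) (ren r a) (ren r b)
  | Refl a => Refl (ren r a)
  | J C d p => J (ren (rup (rup r)) C) (ren r d) (ren r p)
  | Ext k psi phi A a => Ext k psi phi (ren r A) (ren r a)
  | ELam k b => ELam k (ren r b)
  | EApp f p => EApp (ren r f) p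
  | RecOr phi psi a b => RecOr phi psi (ren r a) (ren r b)
  end.

Definition wk (k : nat) : tm -> tm := ren (addn k).

Definition sup (s : nat -> tm) : nat -> tm := fun i =>
  if i is j.+1 then wk 1 (s j) else Var 0.

Definition siup (k : nat) (s : nat -> tm) : nat -> tm := fun i => iwk k (s i).

Fixpoint subst (s : nat -> tm) (t : tm) : tm :=
  match t with
  | Var i => s i
  | U _ | RecBot | FunExt _ _ | ExtExt _ _ _ _ => t
  | Pi A B => Pi (subst s A) (subst (sup s) B)
  | Lam b => Lam (subst (sup s) b)
  | App f a => App (subst s f) (subst s a)
  | Sig A B => Sig (subst s A) (subst (sup s) B)
  | Pair a b => Pair (subst s a) (subst s b)
  | Fst p => Fst (subst s p)
  | Snd p => Snd (subst s p)
  | Id A a b => Id (subst s A) (subst s a) (subst s b)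
  | Refl a => Refl (subst s a)
  | J C d p => J (subst (sup (sup s)) C) (subst s d) (subst s p)
  | Ext k psi phi A a =>
      Ext k psi phi (subst (siup k s) A) (subst (siup k s) a)
  | ELam k b => ELam k (subst (siup k s) b)
  | EApp f p => EApp (subst s f) p
  | RecOr phi psi a b => RecOr phi psi (subst s a) (subst s b)
  end.

Definition subst1 (a : tm) (b : tm) : tm :=
  subst (fun i => if i is j.+1 then Var j else a) b.

(* [subst2 b p C] is C[b/1, p/0]. *)
Definition subst2 (b p : tm) (C : tm) : tm :=
  subst (fun i => match i with 0 => p | 1 => b | j.+2 => Var j end) C.

Definition atp (p : seq ival) (b : tm) : tm := isubst (inst p) b.

Definition Arrow (A B : tm) : tm := Pi A (wk 1 B).

Definition Prod (A B : tm) : tm := Sig A (wk 1 B).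

(* The product of a family given as a function B : A -> U. *)
Definition PiFam (A B : tm) : tm := Pi A (App (wk 1 B) (Var 0)).

Definition idfun : tm := Lam (Var 0).

Definition comp (g f : tm) : tm := Lam (App (wk 1 g) (App (wk 1 f) (Var 0))).

Definition isContr (X : tm) : tm :=
  Sig X (Pi (wk 1 X) (Id (wk 2 X) (Var 1) (Var 0))).

Definition isEquiv (X Y f : tm) : tm :=
  Prod
    (Sig (Arrow Y X) (Id (wk 1 (Arrow X X)) (comp (Var 0) (wk 1 f)) idfun))
    (Sig (Arrow Y X) (Id (wk 1 (Arrow Y Y)) (comp (wk 1 f) (Var 0)) idfun)).

(* The canonical map (f = g) -> prod_(x : X) (f x = g x), for A : X -> U; it is
   defined by identity elimination, hence does not mention g. *)
Definition happly (X A f : tm) : tm :=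
  Lam (J (Pi (wk 3 X) (Id (App (wk 4 A) (Var 0))
                          (App (wk 4 f) (Var 0)) (App (Var 2) (Var 0))))
         (Lam (Refl (App (wk 2 f) (Var 0))))
         (Var 0)).

Definition FunExtTy (i j : nat) : tm :=
  (* X : U_i, A : X -> U_j, f g : prod_(x : X) A x *)
  Pi (U i)
  (Pi (Arrow (Var 0) (U j))
  (Pi (PiFam (Var 1) (Var 0))
  (Pi (PiFam (Var 2) (Var 1))
  (isEquiv
    (Id (PiFam (Var 3) (Var 2)) (Var 1) (Var 0))
    (Pi (Var 3)
        (Id (App (Var 3) (Var 0)) (App (Var 2) (Var 0)) (App (Var 1) (Var 0))))
    (happly (Var 3) (Var 2) (Var 1)))))).

(* f(t) for t the point of 2^k bound last. *)
Definition eappv (k : nat) (f : tm) : tm := EApp (iwk k f) (ivars k).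

(* < prod_(t : psi) A(t) |^phi_a >, for A over psi and a over phi given as
   elements of extension types with empty boundary. *)
Definition ExtFam (k : nat) (psi phi : tope) (A a : tm) : tm :=
  Ext k psi phi (eappv k A) (eappv k a).

(* < prod_(t : psi) (f(t) = g(t)) |^phi_refl > *)
Definition ExtId (k : nat) (psi phi : tope) (A f g : tm) : tm :=
  Ext k psi phi (Id (eappv k A) (eappv k f) (eappv k g)) (Refl (eappv k f)).

(* The canonical map (f = g) -> < prod_(t : psi) (f(t) = g(t)) |^phi_refl >. *)
Definition extapply (k : nat) (psi phi : tope) (A f : tm) : tm :=
  Lam (J (ExtId k psi phi (wk 3 A) (wk 3 f) (Var 1))
         (ELam k (Refl (eappv k (wk 1 f))))
         (Var 0)).

Definition ExtExtTy (i k : nat) (psi phi : tope) : tm :=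
  (* A : psi -> U_i, a : prod_(t : phi) A(t), f g : < prod_(t : psi) A(t) |^phi_a > *)
  Pi (Ext k psi TBot (U i) RecBot)
  (Pi (Ext k phi TBot (eappv k (Var 0)) RecBot)
  (Pi (ExtFam k psi phi (Var 1) (Var 0))
  (Pi (ExtFam k psi phi (Var 2) (Var 1))
  (isEquiv
    (Id (ExtFam k psi phi (Var 3) (Var 2)) (Var 1) (Var 0))
    (ExtId k psi phi (Var 3) (Var 1) (Var 0))
    (extapply k psi phi (Var 3) (Var 1)))))).

(* A context Xi | Phi | Gamma, with the last declared variable at the head. *)
Record ctx : Type := Ctx { cdim : nat; ctopes : seq tope; cvars : seq tm }.

Definition empty_ctx : ctx := Ctx 0 [::] [::].

Definition add_var (G : ctx) (A : tm) : ctx :=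
  Ctx (cdim G) (ctopes G) (A :: cvars G).

Definition add_tope (G : ctx) (phi : tope) : ctx :=
  Ctx (cdim G) (phi :: ctopes G) (cvars G).

Definition add_shape (G : ctx) (k : nat) (psi : tope) : ctx :=
  Ctx (k + cdim G) (psi :: [seq tope_subst (ishift k) p | p <- ctopes G])
      [seq iwk k A | A <- cvars G].

Definition holds (G : ctx) (phi : tope) : Prop := entails (cdim G) (ctopes G) phi.

Definition is_shape_incl (k : nat) (psi phi : tope) : Prop :=
  [/\ tope_wf k psi, tope_wf k phi & entails k [:: phi] psi].

Definition is_point (G : ctx) (k : nat) (psi : tope) (p : seq ival) : Prop :=
  [/\ size p = k, all (ival_wf (cdim G)) p & holds G (tope_subst (inst p) psi)].

Definition eq_point (G : ctx) (p q : seq ival) : Prop :=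
  [/\ size p = size q, all (ival_wf (cdim G)) q &
      forall i, i < size p -> holds G (TEq (nth I0 p i) (nth I0 q i))].

Reserved Notation "G ⊢ t ∈ A" (at level 70, t at level 69, A at level 69).
Reserved Notation "G ⊢ t ≡ u ∈ A"
  (at level 70, t at level 69, u at level 69, A at level 69).

(* Types are the elements of the universes U 0 : U 1 : ... (Russell style, not
   cumulative); [G ⊢ A ∈ U i] reads "A is a type".  *)
Inductive ctx_ok : ctx -> Prop :=
| ok_empty : ctx_ok empty_ctx
| ok_var G A i : G ⊢ A ∈ U i -> ctx_ok (add_var G A)
| ok_tope G phi : ctx_ok G -> tope_wf (cdim G) phi -> ctx_ok (add_tope G phi)
| ok_shape G k psi : ctx_ok G -> tope_wf k psi -> ctx_ok (add_shape G k psi)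

with typed : ctx -> tm -> tm -> Prop :=
| ty_var G k :
    ctx_ok G -> k < size (cvars G) ->
    G ⊢ Var k ∈ wk k.+1 (nth (U 0) (cvars G) k)
| ty_conv G t A B i : G ⊢ t ∈ A -> G ⊢ A ≡ B ∈ U i -> G ⊢ t ∈ B
| ty_U G i : ctx_ok G -> G ⊢ U i ∈ U i.+1
| ty_Pi G A B i j :
    G ⊢ A ∈ U i -> add_var G A ⊢ B ∈ U j -> G ⊢ Pi A B ∈ U (maxn i j)
| ty_Lam G A B b : add_var G A ⊢ b ∈ B -> G ⊢ Lam b ∈ Pi A B
| ty_App G A B f a : G ⊢ f ∈ Pi A B -> G ⊢ a ∈ A -> G ⊢ App f a ∈ subst1 a B
| ty_Sig G A B i j :
    G ⊢ A ∈ U i -> add_var G A ⊢ B ∈ U j -> G ⊢ Sig A B ∈ U (maxn i j)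
| ty_Pair G A B a b j :
    add_var G A ⊢ B ∈ U j -> G ⊢ a ∈ A -> G ⊢ b ∈ subst1 a B ->
    G ⊢ Pair a b ∈ Sig A B
| ty_Fst G A B p : G ⊢ p ∈ Sig A B -> G ⊢ Fst p ∈ A
| ty_Snd G A B p : G ⊢ p ∈ Sig A B -> G ⊢ Snd p ∈ subst1 (Fst p) B
| ty_Id G A a b i :
    G ⊢ A ∈ U i -> G ⊢ a ∈ A -> G ⊢ b ∈ A -> G ⊢ Id A a b ∈ U i
| ty_Refl G A a : G ⊢ a ∈ A -> G ⊢ Refl a ∈ Id A a a
| ty_J G A a C d b p j :
    add_var (add_var G A) (Id (wk 1 A) (wk 1 a) (Var 0)) ⊢ C ∈ U j ->
    G ⊢ d ∈ subst2 a (Refl a) C -> G ⊢ b ∈ A -> G ⊢ p ∈ Id A a b ->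
    G ⊢ J C d p ∈ subst2 b p C
| ty_Ext G k psi phi A a i :
    is_shape_incl k psi phi ->
    add_shape G k psi ⊢ A ∈ U i -> add_shape G k phi ⊢ a ∈ A ->
    G ⊢ Ext k psi phi A a ∈ U i
| ty_ELam G k psi phi A a b i :
    G ⊢ Ext k psi phi A a ∈ U i ->
    add_shape G k psi ⊢ b ∈ A -> add_shape G k phi ⊢ b ≡ a ∈ A ->
    G ⊢ ELam k b ∈ Ext k psi phi A a
| ty_EApp G k psi phi A a f p :
    G ⊢ f ∈ Ext k psi phi A a -> is_point G k psi p -> G ⊢ EApp f p ∈ atp p A
| ty_RecBot G A i : G ⊢ A ∈ U i -> holds G TBot -> G ⊢ RecBot ∈ A
| ty_RecOr G phi psi a b A i :
    G ⊢ A ∈ U i -> tope_wf (cdim G) phi -> tope_wf (cdim G) psi ->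
    holds G (TOr phi psi) ->
    add_tope G phi ⊢ a ∈ A -> add_tope G psi ⊢ b ∈ A ->
    add_tope (add_tope G phi) psi ⊢ a ≡ b ∈ A ->
    G ⊢ RecOr phi psi a b ∈ A
| ty_FunExt G i j : ctx_ok G -> G ⊢ FunExt i j ∈ FunExtTy i j
| ty_ExtExt G i k psi phi :
    ctx_ok G -> is_shape_incl k psi phi ->
    G ⊢ ExtExt i k psi phi ∈ ExtExtTy i k psi phi

with conv : ctx -> tm -> tm -> tm -> Prop :=
| cv_refl G t A : G ⊢ t ∈ A -> G ⊢ t ≡ t ∈ A
| cv_sym G t u A : G ⊢ t ≡ u ∈ A -> G ⊢ u ≡ t ∈ A
| cv_trans G t u v A : G ⊢ t ≡ u ∈ A -> G ⊢ u ≡ v ∈ A -> G ⊢ t ≡ v ∈ A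
| cv_conv G t u A B i : G ⊢ t ≡ u ∈ A -> G ⊢ A ≡ B ∈ U i -> G ⊢ t ≡ u ∈ B
| cv_Pi G A A' B B' i j :
    G ⊢ A ≡ A' ∈ U i -> add_var G A ⊢ B ≡ B' ∈ U j ->
    G ⊢ Pi A B ≡ Pi A' B' ∈ U (maxn i j)
| cv_Lam G A B b b' :
    add_var G A ⊢ b ≡ b' ∈ B -> G ⊢ Lam b ≡ Lam b' ∈ Pi A B
| cv_App G A B f f' a a' :
    G ⊢ f ≡ f' ∈ Pi A B -> G ⊢ a ≡ a' ∈ A ->
    G ⊢ App f a ≡ App f' a' ∈ subst1 a B
| cv_Sig G A A' B B' i j :
    G ⊢ A ≡ A' ∈ U i -> add_var G A ⊢ B ≡ B' ∈ U j ->
    G ⊢ Sig A B ≡ Sig A' B' ∈ U (maxn i j)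
| cv_Pair G A B a a' b b' j :
    add_var G A ⊢ B ∈ U j -> G ⊢ a ≡ a' ∈ A -> G ⊢ b ≡ b' ∈ subst1 a B ->
    G ⊢ Pair a b ≡ Pair a' b' ∈ Sig A B
| cv_Fst G A B p p' : G ⊢ p ≡ p' ∈ Sig A B -> G ⊢ Fst p ≡ Fst p' ∈ A
| cv_Snd G A B p p' :
    G ⊢ p ≡ p' ∈ Sig A B -> G ⊢ Snd p ≡ Snd p' ∈ subst1 (Fst p) B
| cv_Id G A A' a a' b b' i :
    G ⊢ A ≡ A' ∈ U i -> G ⊢ a ≡ a' ∈ A -> G ⊢ b ≡ b' ∈ A ->
    G ⊢ Id A a b ≡ Id A' a' b' ∈ U i
| cv_Refl G A a a' : G ⊢ a ≡ a' ∈ A -> G ⊢ Refl a ≡ Refl a' ∈ Id A a a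
| cv_J G A a C C' d d' b p p' j :
    add_var (add_var G A) (Id (wk 1 A) (wk 1 a) (Var 0)) ⊢ C ≡ C' ∈ U j ->
    G ⊢ d ≡ d' ∈ subst2 a (Refl a) C -> G ⊢ b ∈ A -> G ⊢ p ≡ p' ∈ Id A a b ->
    G ⊢ J C d p ≡ J C' d' p' ∈ subst2 b p C
| cv_Ext G k psi phi A A' a a' i :
    is_shape_incl k psi phi ->
    add_shape G k psi ⊢ A ≡ A' ∈ U i -> add_shape G k phi ⊢ a ≡ a' ∈ A ->
    G ⊢ Ext k psi phi A a ≡ Ext k psi phi A' a' ∈ U i
| cv_ELam G k psi phi A a b b' i :
    G ⊢ Ext k psi phi A a ∈ U i ->
    add_shape G k psi ⊢ b ≡ b' ∈ A -> add_shape G k phi ⊢ b ≡ a ∈ A ->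
    G ⊢ ELam k b ≡ ELam k b' ∈ Ext k psi phi A a
| cv_EApp G k psi phi A a f f' p p' :
    G ⊢ f ≡ f' ∈ Ext k psi phi A a -> is_point G k psi p -> eq_point G p p' ->
    G ⊢ EApp f p ≡ EApp f' p' ∈ atp p A
| cv_Pi_beta G A B a b :
    add_var G A ⊢ b ∈ B -> G ⊢ a ∈ A ->
    G ⊢ App (Lam b) a ≡ subst1 a b ∈ subst1 a B
| cv_Pi_eta G A B f :
    G ⊢ f ∈ Pi A B -> G ⊢ f ≡ Lam (App (wk 1 f) (Var 0)) ∈ Pi A B
| cv_Sig_beta1 G A B a b j :
    add_var G A ⊢ B ∈ U j -> G ⊢ a ∈ A -> G ⊢ b ∈ subst1 a B ->
    G ⊢ Fst (Pair a b) ≡ a ∈ A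
| cv_Sig_beta2 G A B a b j :
    add_var G A ⊢ B ∈ U j -> G ⊢ a ∈ A -> G ⊢ b ∈ subst1 a B ->
    G ⊢ Snd (Pair a b) ≡ b ∈ subst1 a B
| cv_Sig_eta G A B p :
    G ⊢ p ∈ Sig A B -> G ⊢ p ≡ Pair (Fst p) (Snd p) ∈ Sig A B
| cv_J_beta G A a C d j :
    add_var (add_var G A) (Id (wk 1 A) (wk 1 a) (Var 0)) ⊢ C ∈ U j ->
    G ⊢ a ∈ A -> G ⊢ d ∈ subst2 a (Refl a) C ->
    G ⊢ J C d (Refl a) ≡ d ∈ subst2 a (Refl a) C
| cv_Ext_beta G k psi A b p :
    tope_wf k psi -> add_shape G k psi ⊢ b ∈ A -> is_point G k psi p ->
    G ⊢ EApp (ELam k b) p ≡ atp p b ∈ atp p A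
| cv_Ext_eta G k psi phi A a f :
    G ⊢ f ∈ Ext k psi phi A a -> G ⊢ f ≡ ELam k (eappv k f) ∈ Ext k psi phi A a
| cv_Ext_bd G k psi phi A a f p :
    G ⊢ f ∈ Ext k psi phi A a -> is_point G k phi p ->
    G ⊢ EApp f p ≡ atp p a ∈ atp p A
(* [cv_RecOr_uniq] is the eta rule for [RecOr]; congruence of [RecOr] follows
   from it and the two computation rules. *)
| cv_RecBot G A t u :
    G ⊢ t ∈ A -> G ⊢ u ∈ A -> holds G TBot -> G ⊢ t ≡ u ∈ A
| cv_RecOr1 G phi psi a b A :
    G ⊢ RecOr phi psi a b ∈ A -> G ⊢ a ∈ A -> holds G phi ->
    G ⊢ RecOr phi psi a b ≡ a ∈ A
| cv_RecOr2 G phi psi a b A :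
    G ⊢ RecOr phi psi a b ∈ A -> G ⊢ b ∈ A -> holds G psi ->
    G ⊢ RecOr phi psi a b ≡ b ∈ A
| cv_RecOr_uniq G phi psi t u A :
    G ⊢ t ∈ A -> G ⊢ u ∈ A -> holds G (TOr phi psi) ->
    add_tope G phi ⊢ t ≡ u ∈ A -> add_tope G psi ⊢ t ≡ u ∈ A -> G ⊢ t ≡ u ∈ A

where "G ⊢ t ∈ A" := (typed G t A)
and "G ⊢ t ≡ u ∈ A" := (conv G t u A).

Definition Delta1 : tope := TTop.

Definition bdDelta1 : tope := TOr (TEq (IVar 0) I0) (TEq (IVar 0) I1).

Definition Delta2 : tope := TLe (IVar 1) (IVar 0).

Definition bdDelta2 : tope :=
  TOr (TEq (IVar 1) I0) (TOr (TEq (IVar 1) (IVar 0)) (TEq (IVar 0) I1)).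

(* The partial section [a, b] over the boundary of Delta1. *)
Definition ends (a b : tm) : tm :=
  RecOr (TEq (IVar 0) I0) (TEq (IVar 0) I1) (iwk 1 a) (iwk 1 b).

Definition Hom (A a b : tm) : tm := Ext 1 Delta1 bdDelta1 (iwk 1 A) (ends a b).

Definition idarr (x : tm) : tm := ELam 1 (iwk 1 x).

(* The partial section [f, g; h] over the boundary of Delta2. *)
Definition triangle (f g h : tm) : tm :=
  RecOr (TEq (IVar 1) I0) (TOr (TEq (IVar 1) (IVar 0)) (TEq (IVar 0) I1))
    (EApp (iwk 2 f) [:: IVar 0])
    (RecOr (TEq (IVar 1) (IVar 0)) (TEq (IVar 0) I1)
       (EApp (iwk 2 h) [:: IVar 0])
       (EApp (iwk 2 g) [:: IVar 1])).

Definition Hom2 (A f g h : tm) : tm :=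
  Ext 2 Delta2 bdDelta2 (iwk 2 A) (triangle f g h).

Definition isSegal (A : tm) : tm :=
  (* x y z : A, f : hom x y, g : hom y z, h : hom x z *)
  Pi A
  (Pi (wk 1 A)
  (Pi (wk 2 A)
  (Pi (Hom (wk 3 A) (Var 2) (Var 1))
  (Pi (Hom (wk 4 A) (Var 2) (Var 1))
  (isContr
    (Sig (Hom (wk 5 A) (Var 4) (Var 2))
         (Hom2 (wk 6 A) (Var 2) (Var 1) (Var 0)))))))).

(* Dependent arrows from u to v over f, in a family C : A -> U. *)
Definition DHom (C f u v : tm) : tm :=
  Ext 1 Delta1 bdDelta1 (App (iwk 1 C) (EApp (iwk 1 f) [:: IVar 0])) (ends u v).

Definition isCovariant (A C : tm) : tm :=
  (* x y : A, f : hom x y, u : C x, v : C y *)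
  Pi A
  (Pi (wk 1 A)
  (Pi (Hom (wk 2 A) (Var 1) (Var 0))
  (Pi (App (wk 3 C) (Var 2))
  (isContr
    (Sig (App (wk 4 C) (Var 2))
         (DHom (wk 5 C) (Var 2) (Var 1) (Var 0))))))).

(* prod_(z : A) (hom_A(a, z) -> C z) *)
Definition RepMaps (A a C : tm) : tm :=
  Pi A (Arrow (Hom (wk 1 A) (wk 1 a) (Var 0)) (App (wk 1 C) (Var 0))).

Definition evid (a : tm) : tm :=
  Lam (App (App (Var 0) (wk 1 a)) (idarr (wk 1 a))).

(* Main.v *)
Require Import Defs.
From mathcomp Require Import all_boot.

(* Covariance gives a transport f_* : C a -> C z along f : hom a z, and the
   inverse of evid is u |-> (z, f |-> f_* u).  By contractibility, f_* u = v as
   soon as there is a dependent arrow from u to v over f.  The constant arrow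
   at u over id_a gives (id_a)_* u = u.  For phi in the product, the arrow
   t |-> phi (f t) (s |-> f (min t s)) from phi a id_a to phi z f gives
   f_* (phi a id_a) = phi z f; here min is written with [RecOr], by totality of
   the order on the interval.  Function extensionality concludes. *)

Set Implicit Arguments.
Unset Strict Implicit.
Unset Printing Implicit Defensive.

(** * Derived rules *)

(* Weakening and substitution are never needed as theorems: every context below
   is an explicit extension of some G, so weakened judgments are derived afresh.
   In the rules [*_ok], a premise in an extended context may assume that this
   context is well formed, so that this is derived only once. *)

Lemma ty_eq G t A B : G ⊢ t ∈ A -> A = B -> G ⊢ t ∈ B.
Proof. by move=> ? <-. Qed.

Lemma ty_var_at G k T :
  ctx_ok G -> k < size (cvars G) -> wk k.+1 (nth (U 0) (cvars G) k) = T ->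
  G ⊢ Var k ∈ T.
Proof. by move=> ? ? <-; apply: ty_var. Qed.

Lemma ty_Pi_ok G A B i j :
  G ⊢ A ∈ U i -> (ctx_ok (add_var G A) -> add_var G A ⊢ B ∈ U j) ->
  G ⊢ Pi A B ∈ U (maxn i j).
Proof. by move=> hA hB; apply: ty_Pi => //; apply: hB; apply: ok_var hA. Qed.

Lemma ty_Sig_ok G A B i j :
  G ⊢ A ∈ U i -> (ctx_ok (add_var G A) -> add_var G A ⊢ B ∈ U j) ->
  G ⊢ Sig A B ∈ U (maxn i j).
Proof. by move=> hA hB; apply: ty_Sig => //; apply: hB; apply: ok_var hA. Qed.

Lemma ty_Lam_ok G A B b i :
  G ⊢ A ∈ U i -> (ctx_ok (add_var G A) -> add_var G A ⊢ b ∈ B) ->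
  G ⊢ Lam b ∈ Pi A B.
Proof. by move=> hA hb; apply: ty_Lam; apply: hb; apply: ok_var hA. Qed.

Lemma cv_beta_ok G A B a b b' i T :
  G ⊢ A ∈ U i -> (ctx_ok (add_var G A) -> add_var G A ⊢ b ∈ B) -> G ⊢ a ∈ A ->
  subst1 a b = b' -> subst1 a B = T -> G ⊢ App (Lam b) a ≡ b' ∈ T.
Proof. by move=> hA hb ha <- <-; apply: cv_Pi_beta (hb (ok_var hA)) ha. Qed.

Lemma ty_Pair_ok G A B a b i j :
  G ⊢ A ∈ U i -> (ctx_ok (add_var G A) -> add_var G A ⊢ B ∈ U j) ->
  G ⊢ a ∈ A -> G ⊢ b ∈ subst1 a B ->
  G ⊢ Pair a b ∈ Sig A B.
Proof. by move=> hA hB ? ?; apply: ty_Pair => //; apply: hB; apply: ok_var hA. Qed.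

Lemma ty_J_ok G A a C d b p i j k T
    (G' := add_var (add_var G A) (Id (wk 1 A) (wk 1 a) (Var 0))) :
  G ⊢ A ∈ U i ->
  (ctx_ok (add_var G A) -> add_var G A ⊢ Id (wk 1 A) (wk 1 a) (Var 0) ∈ U k) ->
  (ctx_ok G' -> G' ⊢ C ∈ U j) ->
  G ⊢ d ∈ subst2 a (Refl a) C -> G ⊢ b ∈ A -> G ⊢ p ∈ Id A a b ->
  subst2 b p C = T -> G ⊢ J C d p ∈ T.
Proof.
move=> hA hI hC hd hb hp <-; apply: ty_J hd hb hp.
by apply: hC; apply: ok_var (hI (ok_var hA)).
Qed.

Lemma ty_RecOr_ok G phi psi a b A i :
  ctx_ok G -> G ⊢ A ∈ U i -> tope_wf (cdim G) phi -> tope_wf (cdim G) psi ->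
  holds G (TOr phi psi) ->
  (ctx_ok (add_tope G phi) -> add_tope G phi ⊢ a ∈ A) ->
  (ctx_ok (add_tope G psi) -> add_tope G psi ⊢ b ∈ A) ->
  (ctx_ok (add_tope (add_tope G phi) psi) ->
     add_tope (add_tope G phi) psi ⊢ a ≡ b ∈ A) ->
  G ⊢ RecOr phi psi a b ∈ A.
Proof.
move=> hG hA h1 h2 h ha hb hab; have k1 := ok_tope hG h1.
by apply: ty_RecOr hA _ _ _ (ha _) (hb _) (hab _) => //; apply: ok_tope.
Qed.

Lemma ty_Ext_ok G k psi phi A a i :
  ctx_ok G -> is_shape_incl k psi phi ->
  (ctx_ok (add_shape G k psi) -> add_shape G k psi ⊢ A ∈ U i) ->
  (ctx_ok (add_shape G k phi) -> add_shape G k phi ⊢ a ∈ A) ->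
  G ⊢ Ext k psi phi A a ∈ U i.
Proof.
move=> hG [w1 w2 h] hA ha.
by apply: ty_Ext; [split | apply/hA/ok_shape | apply/ha/ok_shape].
Qed.

Lemma ty_ELam_ok G k psi phi A a b i :
  ctx_ok G -> is_shape_incl k psi phi ->
  (ctx_ok (add_shape G k psi) -> add_shape G k psi ⊢ A ∈ U i) ->
  (ctx_ok (add_shape G k phi) -> add_shape G k phi ⊢ a ∈ A) ->
  (ctx_ok (add_shape G k psi) -> add_shape G k psi ⊢ b ∈ A) ->
  (ctx_ok (add_shape G k phi) -> add_shape G k phi ⊢ b ≡ a ∈ A) ->
  G ⊢ ELam k b ∈ Ext k psi phi A a.
Proof.
move=> hG hs hA ha hb hba; case: (hs) => w1 w2 _.
by apply: ty_ELam (ty_Ext_ok hG hs hA ha) (hb _) (hba _); apply: ok_shape.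
Qed.

Lemma cv_Ext_ok G k psi phi A A' a a' i :
  ctx_ok G -> is_shape_incl k psi phi ->
  (ctx_ok (add_shape G k psi) -> add_shape G k psi ⊢ A ≡ A' ∈ U i) ->
  (ctx_ok (add_shape G k phi) -> add_shape G k phi ⊢ a ≡ a' ∈ A) ->
  G ⊢ Ext k psi phi A a ≡ Ext k psi phi A' a' ∈ U i.
Proof.
move=> hG hs hA ha; case: (hs) => w1 w2 _.
by apply: cv_Ext hs (hA _) (ha _); apply: ok_shape.
Qed.

Lemma cv_ELam_ok G k psi phi A a b b' i :
  ctx_ok G -> tope_wf k psi -> tope_wf k phi ->
  G ⊢ Ext k psi phi A a ∈ U i ->
  (ctx_ok (add_shape G k psi) -> add_shape G k psi ⊢ b ≡ b' ∈ A) ->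
  (ctx_ok (add_shape G k phi) -> add_shape G k phi ⊢ b ≡ a ∈ A) ->
  G ⊢ ELam k b ≡ ELam k b' ∈ Ext k psi phi A a.
Proof.
move=> hG w1 w2 hE hb ha.
by apply: cv_ELam hE (hb _) (ha _); apply: ok_shape.
Qed.

Lemma ty_EApp_ELam G k A b p i :
  ctx_ok G ->
  (ctx_ok (add_shape G k TTop) -> add_shape G k TTop ⊢ A ∈ U i) ->
  (ctx_ok (add_shape G k TTop) -> add_shape G k TTop ⊢ b ∈ A) ->
  is_point G k TTop p -> G ⊢ EApp (ELam k b) p ∈ atp p A.
Proof.
move=> hG hA hb; have hs : is_shape_incl k TTop TTop by split=> //; apply: ent_top.
by apply: ty_EApp; apply: (ty_ELam_ok hG hs hA hb hb) => /hb; apply: cv_refl.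
Qed.

Lemma cv_EApp_ELam G k A b p :
  ctx_ok G -> (ctx_ok (add_shape G k TTop) -> add_shape G k TTop ⊢ b ∈ A) ->
  is_point G k TTop p -> G ⊢ EApp (ELam k b) p ≡ atp p b ∈ atp p A.
Proof.
by move=> hG hb hp; apply: (@cv_Ext_beta _ _ TTop) hp => //; apply/hb/ok_shape.
Qed.

Lemma cv_RecOr_uniq_ok G phi psi t u A :
  ctx_ok G -> tope_wf (cdim G) phi -> tope_wf (cdim G) psi ->
  G ⊢ t ∈ A -> G ⊢ u ∈ A -> holds G (TOr phi psi) ->
  (ctx_ok (add_tope G phi) -> add_tope G phi ⊢ t ≡ u ∈ A) ->
  (ctx_ok (add_tope G psi) -> add_tope G psi ⊢ t ≡ u ∈ A) ->
  G ⊢ t ≡ u ∈ A.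
Proof.
move=> hG w1 w2 ht hu h h1 h2.
by apply: cv_RecOr_uniq ht hu h (h1 _) (h2 _); apply: ok_tope.
Qed.

(** * Topes and boundaries of shapes *)

Lemma ent_at n Phi phi k :
  k < size Phi -> nth TTop Phi k = phi -> entails n Phi phi.
Proof. by move=> ? <-; apply: ent_hyp. Qed.

Lemma bdDelta1_incl : is_shape_incl 1 Delta1 bdDelta1.
Proof. by split=> //; apply: ent_top. Qed.

(** The three edges give s = 0 ≤ t, s = t, and s ≤ 1 = t. *)
Lemma bdDelta2_incl : is_shape_incl 2 Delta2 bdDelta2.
Proof.
split=> //; apply: (ent_or (@ent_at _ [:: bdDelta2] _ 0 isT erefl)).
  apply: (ent_le_trans (y := I0)); last by apply: ent_le0.
  by apply/ent_le_eq/(@ent_at _ _ _ 0).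
apply: (ent_or (@ent_at _ (_ :: [:: bdDelta2]) _ 0 isT erefl)).
  by apply/ent_le_eq/(@ent_at _ _ _ 0).
apply: (ent_le_trans (y := I1)); first by apply: ent_le1.
by apply/ent_le_eq/ent_eq_sym/(@ent_at _ _ _ 0).
Qed.

Lemma cv_eq G t t' u u' A B :
  G ⊢ t ≡ u ∈ A -> t = t' -> u = u' -> A = B -> G ⊢ t' ≡ u' ∈ B.
Proof. by move=> ? <- <- <-. Qed.

(** The boundary at [p] is a [RecOr] whose first tope holds. Its instance at [p] is assumed well
    typed, which replaces a substitution theorem. *)
Lemma cv_src G f p A x y :
  G ⊢ f ∈ Ext 1 Delta1 bdDelta1 A (RecOr (TEq (IVar 0) I0) (TEq (IVar 0) I1) x y) ->
  ival_wf (cdim G) p -> holds G (TEq p I0) ->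
  G ⊢ RecOr (TEq p I0) (TEq p I1) (atp [:: p] x) (atp [:: p] y) ∈ atp [:: p] A ->
  G ⊢ atp [:: p] x ∈ atp [:: p] A ->
  G ⊢ EApp f [:: p] ≡ atp [:: p] x ∈ atp [:: p] A.
Proof.
move=> hf wp hp hr hx.
have hpt : is_point G 1 bdDelta1 [:: p].
  by split => //=; [rewrite wp | apply: ent_orl => //=; rewrite ?wp].
exact: cv_trans (cv_Ext_bd hf hpt) (cv_RecOr1 hr hx hp).
Qed.

Lemma cv_tgt G f p A x y :
  G ⊢ f ∈ Ext 1 Delta1 bdDelta1 A (RecOr (TEq (IVar 0) I0) (TEq (IVar 0) I1) x y) ->
  ival_wf (cdim G) p -> holds G (TEq p I1) ->
  G ⊢ RecOr (TEq p I0) (TEq p I1) (atp [:: p] x) (atp [:: p] y) ∈ atp [:: p] A ->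
  G ⊢ atp [:: p] y ∈ atp [:: p] A ->
  G ⊢ EApp f [:: p] ≡ atp [:: p] y ∈ atp [:: p] A.
Proof.
move=> hf wp hp hr hy.
have hpt : is_point G 1 bdDelta1 [:: p].
  by split => //=; [rewrite wp | apply: ent_orr => //=; rewrite ?wp].
exact: cv_trans (cv_Ext_bd hf hpt) (cv_RecOr2 hr hy hp).
Qed.

(** * Renaming, substitution and function extensionality *)

Lemma ren_comp t r r' r'' :
  (forall n, r (r' n) = r'' n) -> ren r (ren r' t) = ren r'' t.
Proof.
have up q q' q'' : (forall n, q (q' n) = q'' n) -> forall n, rup q (rup q' n) = rup q'' n.
  by move=> e [|n] //=; rewrite e.
by elim: t r r' r'' => //= *; f_equal; eauto.
Qed.

Lemma subst_ren t s r s' :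
  (forall n, s (r n) = s' n) -> subst s (ren r t) = subst s' t.
Proof.
have up q p q' : (forall n, q (p n) = q' n) -> forall n, sup q (rup p n) = sup q' n.
  by move=> e [|n] //=; rewrite e.
have iup k q p q' : (forall n, q (p n) = q' n) -> forall n, siup k q (p n) = siup k q' n.
  by move=> e n; rewrite /siup e.
by elim: t s r s' => //= *; f_equal; eauto.
Qed.

Lemma subst_is_ren t s r : (forall n, s n = Var (r n)) -> subst s t = ren r t.
Proof.
have up q p : (forall n, q n = Var (p n)) -> forall n, sup q n = Var (rup p n).
  by move=> e [|n] //=; rewrite e.
have iup k q p : (forall n, q n = Var (p n)) -> forall n, siup k q n = Var (p n).
  by move=> e n; rewrite /siup e.
by elim: t s r => //= *; f_equal; eauto.
Qed.

Lemma subst_id t s : (forall n, s n = Var n) -> subst s t = t.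
Proof.
have up q : (forall n, q n = Var n) -> forall n, sup q n = Var n.
  by move=> e [|n] //=; rewrite e.
have iup k q : (forall n, q n = Var n) -> forall n, siup k q n = Var n.
  by move=> e n; rewrite /siup e.
by elim: t s => //= *; f_equal; eauto.
Qed.

Definition inst1 (a : tm) : nat -> tm := fun i => if i is j.+1 then Var j else a.

(** All free variables of [wk k.+1 t] lie above the substituted index [k], so they are only lowered
    by one. *)
Lemma subst_wk k a t : subst (iter k sup (inst1 a)) (wk k.+1 t) = wk k t.
Proof.
apply: etrans (_ : subst (fun n => Var (k + n)) t = _); last exact: subst_is_ren.
by apply: subst_ren; elim: k => // k IH n; rewrite addSn /= IH.
Qed.

Lemma wk_wk m n t : wk m (wk n t) = wk (m + n) t.
Proof. by apply: ren_comp => k; rewrite addnA. Qed.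

(** The first half of [isEquiv] is a left inverse of [happly] with its law; the two projections
    extract the underlying map. *)
Lemma FunExt_app G X L f g i j :
  ctx_ok G -> G ⊢ X ∈ U i -> G ⊢ L ∈ Arrow X (U j) ->
  G ⊢ f ∈ PiFam X L -> G ⊢ g ∈ PiFam X L ->
  G ⊢ Fst (Fst (App (App (App (App (FunExt i j) X) L) f) g)) ∈
    Arrow (Pi X (Id (App (wk 1 L) (Var 0)) (App (wk 1 f) (Var 0)) (App (wk 1 g) (Var 0))))
          (Id (PiFam X L) f g).
Proof.
(* The terms [X], [L], [f], [g] are arbitrary, so evaluation alone cannot cancel substitution
   against weakening. *)
have E a t : subst1 a (wk 1 t) = t.
  by rewrite [LHS](subst_wk 0) /wk -(@subst_is_ren _ Var) // subst_id.
have E1 a t := subst_wk 1 a t; have E2 a t := subst_wk 2 a t.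
have E3 a t := subst_wk 3 a t; rewrite /inst1 /subst1 /= in E E1 E2 E3.
move=> hG hX hL hf hg.
have h1 := ty_App (ty_FunExt i j hG) hX.
have h2 := ty_App h1 hL.
eassert (h3 : G ⊢ App (App (App (FunExt i j) X) L) f ∈ _).
  refine (ty_App (ty_eq h2 _) hf); rewrite {1}/subst1 /=; congr Pi.
  by rewrite /PiFam; congr Pi; apply: E.
eassert (h4 : G ⊢ App (App (App (App (FunExt i j) X) L) f) g ∈ _).
  refine (ty_App (ty_eq h3 _) hg); rewrite {1}/subst1 /=; congr Pi.
  by rewrite !wk_wk !E1 !E.
apply: ty_Fst; apply: ty_Fst; apply: (ty_eq h4).
rewrite {1}/subst1 /=; congr (Sig (Sig (Pi _ _) _) _);
  rewrite !wk_wk ?E3 ?E2 ?wk_wk ?E2 ?E1 ?E //.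
by rewrite /wk /= (@ren_comp L _ _ (addn 2)).
Qed.

(** The axiom expects the family as a function, so [Lam B] is used and the product types are
    compared by beta under the binder. The premise on [ren (rup (addn 1)) B] is the weakening of [B]
    which that beta step requires. *)
Lemma funext_intro G X B f g i j :
  ctx_ok G -> G ⊢ X ∈ U i ->
  (ctx_ok (add_var G X) -> add_var G X ⊢ B ∈ U j) ->
  (ctx_ok (add_var (add_var G X) (wk 1 X)) ->
     add_var (add_var G X) (wk 1 X) ⊢ ren (rup (addn 1)) B ∈ U j) ->
  (ctx_ok (add_var G X) -> add_var G X ⊢ wk 1 X ∈ U i) ->
  G ⊢ f ∈ Pi X B -> G ⊢ g ∈ Pi X B ->
  (ctx_ok (add_var G X) -> add_var G X ⊢ App (wk 1 f) (Var 0) ∈ B) ->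
  (ctx_ok (add_var G X) -> add_var G X ⊢ App (wk 1 g) (Var 0) ∈ B) ->
  (ctx_ok (add_var G X) -> exists e,
     add_var G X ⊢ e ∈ Id B (App (wk 1 f) (Var 0)) (App (wk 1 g) (Var 0))) ->
  exists e, G ⊢ e ∈ Id (Pi X B) f g.
Proof.
move=> hG hX + + + hf hg; have hGX := ok_var hX.
move=> /(_ hGX) hB + /(_ hGX) hX' /(_ hGX) hf0 /(_ hGX) hg0 /(_ hGX) [e he].
move=> /(_ (ok_var hX')) hB'.
have hL : G ⊢ Lam B ∈ Arrow X (U j) by apply: ty_Lam.
have hx : add_var G X ⊢ Var 0 ∈ wk 1 X.
  by apply: (@ty_var (add_var G X) 0) => //; apply: ok_var hX.
(* Renaming past the new variable and then substituting [Var 0] is the identity substitution. *)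
have hbeta : add_var G X ⊢ App (wk 1 (Lam B)) (Var 0) ≡ B ∈ U j.
  have := cv_Pi_beta hB' hx; rewrite /subst1 (@subst_ren _ _ _ Var); last by case.
  by rewrite subst_id.
have hPi : G ⊢ Pi X B ≡ PiFam X (Lam B) ∈ U (maxn i j).
  by apply: cv_Pi; [apply: cv_refl | apply: cv_sym].
have h := FunExt_app hG hX hL (ty_conv hf hPi) (ty_conv hg hPi).
have hid : add_var G X ⊢ Id B (App (wk 1 f) (Var 0)) (App (wk 1 g) (Var 0))
    ≡ Id (App (wk 1 (Lam B)) (Var 0)) (App (wk 1 f) (Var 0)) (App (wk 1 g) (Var 0)) ∈ U j.
  by apply: cv_Id; [apply: cv_sym | apply: cv_refl | apply: cv_refl].
have he' := ty_Lam (ty_conv he hid).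
exists (App (Fst (Fst (App (App (App (App (FunExt i j) X) (Lam B)) f) g))) (Lam e)).
apply: (ty_conv (A := Id (PiFam X (Lam B)) f g) (i := maxn i j)).
  apply: (ty_eq (ty_App h he')); rewrite /subst1 /wk.
  by rewrite (@subst_ren _ _ _ Var) // subst_id.
by apply/cv_sym/cv_Id => //; apply: cv_refl.
Qed.

(** * Type checking *)

Ltac nf := lazy -[maxn]; reflexivity.

Ltac hyp_tope :=
  let at_ k := eapply (@ent_at _ _ _ k); [reflexivity | reflexivity] in
  at_ 0 + at_ 1 + at_ 2 + at_ 3 + at_ 4.

Ltac eq_hyp := hyp_tope + (apply: ent_eq_sym; hyp_tope).

Ltac eq_tope :=
  (apply: ent_eq_refl; reflexivity) + eq_hyp
  (* This covers the overlap s ≤ t, t ≤ s of the two branches of [connection]. *)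
  + (apply: ent_le_anti; hyp_tope)
  + (eapply ent_eq_trans; [eq_hyp | eq_hyp])
  + (eapply ent_eq_trans; [eq_hyp | eapply ent_eq_trans; [eq_hyp | eq_hyp]]).

Ltac tope :=
  unfold holds;
  lazymatch goal with |- entails ?n ?Phi ?p =>
    let Phi' := eval lazy in Phi in let p' := eval lazy in p in
    change (entails n Phi' p') end;
  lazymatch goal with
  | |- entails _ _ TTop => apply: ent_top
  (* Absurdity arises where the two ends of an arrow overlap, and there 0 = 1. *)
  | |- entails _ _ TBot =>
      apply: ent_neq01; eq_tope
  | |- entails _ _ (TEq _ _) => eq_tope
  | |- entails _ _ (TLe _ _) =>
      hyp_tope + (apply: ent_le_eq; eq_tope) + (apply: ent_le1; reflexivity)
      + (apply: ent_le0; reflexivity)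
      + (eapply ent_le_trans; [apply: ent_le_eq; eq_tope | apply: ent_le0; reflexivity])
      + (eapply ent_le_trans; [apply: ent_le1; reflexivity | apply: ent_le_eq; eq_tope])
  | |- entails _ _ (TOr _ _) =>
      first [ hyp_tope | apply: ent_le_total; reflexivity
            | apply: ent_orl; [reflexivity | tope] | apply: ent_orr; [reflexivity | tope]]
  end.

Ltac once_tope := once tope.

Ltac shape := first [ exact: bdDelta1_incl | exact: bdDelta2_incl
  | split; [reflexivity | reflexivity | once_tope] ].

Ltac point := split; [reflexivity | reflexivity | once_tope].

(* The type of the function of a redex, which cannot be inferred. *)
Ltac lam_type t := fail.

(* Bidirectional type checking, where the context is an explicit extension and
   all components needed for inference are in weak head normal form.  [cv]
   evaluates arrows at endpoints and [RecOr] at true topes, and splits along the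
   disjunction declared last. *)
Ltac tc :=
  lazymatch goal with
  | |- ctx_ok _ => assumption
  | |- ctx_ok _ -> _ => let h := fresh "ok" in intro h; tc
  | |- typed _ ?t ?T =>
    let t' := eval hnf in t in
    change t with t';
    lazymatch goal with
    | |- typed _ (U _) _ => apply: ty_U; assumption
    | |- typed _ (Pi _ _) _ => eapply ty_Pi_ok; tc
    | |- typed _ (Sig _ _) _ => eapply ty_Sig_ok; tc
    | |- typed _ (Lam _) _ => eapply ty_Lam_ok; tc
    | |- typed _ (Pair _ _) _ => eapply ty_Pair_ok; tc
    | |- typed _ (Id _ _ _) _ => eapply ty_Id; [tc | tc | tc]
    | |- typed _ (Ext _ _ _ _ _) _ => eapply ty_Ext_ok; [assumption | shape | tc | tc]
    | |- typed _ (ELam _ _) _ => eapply ty_ELam_ok; [assumption | shape | tc ..]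
    | |- typed _ (RecOr _ _ _ _) _ =>
        eapply ty_RecOr_ok;
          [assumption | tc | reflexivity | reflexivity | once_tope | tc | tc | tc]
    | |- _ => first [infer | eapply ty_conv; [infer | cv]]
    end
  | |- conv _ _ _ _ => cv
  end
with infer :=
  lazymatch goal with
  | |- typed _ (Var _) _ => eapply ty_var_at; [assumption | reflexivity | nf]
  | |- typed _ (App _ _) _ => eapply ty_eq; [eapply ty_App; [fn | tc] | nf]
  | |- typed _ (Fst _) _ => eapply ty_eq; [eapply ty_Fst; tc | nf]
  | |- typed _ (Snd _) _ => eapply ty_eq; [eapply ty_Snd; tc | nf]
  | |- typed _ (Refl _) _ => eapply ty_eq; [eapply ty_Refl; tc | nf]
  | |- typed ?G (EApp (ELam ?k ?b) ?p) _ =>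
    eapply (@ty_eq G (EApp (ELam k b) p)); [eapply ty_EApp_ELam;
      [assumption | | intro; infer | point]; tc | nf]
  | |- typed _ (EApp _ _) _ => eapply ty_eq; [eapply ty_EApp; [tc | point] | nf]
  end
with fn :=
  lazymatch goal with
  | |- typed ?G ?f _ =>
    let f' := eval hnf in f in
    change f with f';
    lazymatch f' with
    | Lam _ => let T := lam_type f' in
       refine (@ty_eq G f' T _ _ _); [tc | nf]
    | _ => tc
    end
  end
with step :=
  lazymatch goal with
  | |- conv ?G (EApp (ELam ?k ?b) ?p) _ _ =>
      eapply (@cv_eq G (EApp (ELam k b) p));
       [ eapply cv_EApp_ELam; [assumption | tc | point] | nf | nf | nf ]
  | |- conv ?G (EApp ?f [:: ?p]) _ _ =>
      eapply cv_eq;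
       [ first [eapply (@cv_src G f p); [ | reflexivity | once_tope | | ]; solve [tc]
        | eapply (@cv_tgt G f p); [ | reflexivity | once_tope | | ]; solve [tc]]
       | nf | nf | nf ]
  | |- conv _ (RecOr _ _ _ _) _ _ =>
      first [eapply cv_RecOr1; [ | | once_tope]; solve [tc]
            |eapply cv_RecOr2; [ | | once_tope]; solve [tc]]
  end
with cv :=
  lazymatch goal with
  | |- conv ?G ?t ?u ?A =>
    let t' := eval hnf in t in let u' := eval hnf in u in
    change t with t'; change u with u'
  end;
  first [ solve [apply: cv_refl; tc]
  | solve [apply: cv_RecBot; [ | | once_tope]; tc]
  | lazymatch goal with
    | |- conv ?G (App ?f ?a) (App ?g ?b) _ => first
      [ solve [eapply cv_eq; [eapply (@cv_App G _ _ f g a b); [cv | cv] | nf | nf | nf]]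
      | solve [apply: cv_sym; eapply cv_eq;
               [eapply (@cv_App G _ _ g f b a); [cv | cv] | nf | nf | nf]] ]
    | |- conv ?G (EApp ?f ?p) (EApp ?g ?q) _ =>
      solve [eapply cv_eq; [eapply (@cv_EApp G _ _ _ _ _ f g p q); 
        [cv | point | split; [reflexivity | reflexivity | case=> [_|//]; once_tope]]
        | nf | nf | nf]]
    | |- conv _ (Ext _ _ _ _ _) (Ext _ _ _ _ _) _ =>
      solve [eapply cv_Ext_ok; [assumption | shape | tc | tc]]
    | |- conv _ (ELam _ _) (ELam _ _) _ =>
      solve [eapply cv_ELam_ok; [assumption | reflexivity | reflexivity | tc | tc | tc]]
    (* Eta: for instance, it identifies [connection f] with [f] at t = 1. *)
    | |- conv _ (ELam ?k _) ?f _ =>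
      solve [apply: (@cv_trans _ _ (ELam k (eappv k f))); [cv | apply/cv_sym/cv_Ext_eta; tc]]
    end
  | eapply cv_trans; [solve [step] | cv]
  | apply: cv_sym; eapply cv_trans; [solve [step] | cv]
  | case_tope ]
with case_tope :=
  lazymatch goal with
  | |- conv ?G _ _ _ =>
    let Phi := eval lazy in (ctopes G) in
    lazymatch Phi with
    | TOr ?p ?q :: _ =>
     eapply (@cv_RecOr_uniq_ok _ p q); [assumption | reflexivity | reflexivity | tc | tc |
      once_tope | tc | tc]
    end
  end.

(** * The equivalence *)

(* y u z f = v if there is a dependent arrow from u to v over f, for
   A = Var 3, C = Var 2, a = Var 1, y = Var 0. *)
Definition transport_spec : tm :=
  Pi (App (Var 2) (Var 1))
  (Pi (Var 4)
  (Pi (Hom (Var 5) (Var 3) (Var 0))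
  (Pi (App (Var 5) (Var 1))
  (Pi (DHom (Var 6) (Var 1) (Var 3) (Var 0))
  (Id (App (Var 7) (Var 3))
      (App (App (App (Var 5) (Var 4)) (Var 3)) (Var 2)) (Var 1)))))).

(* The indices are A = 4, C = 3, a = 2, y = 1 and 0 for its specification. *)
Definition transport_ctx (G : ctx) (i j : nat) : ctx :=
  let G1 := add_var (add_var (add_var G (U i)) (Arrow (Var 0) (U j))) (Var 1) in
  let Y := Arrow (App (Var 1) (Var 0)) (RepMaps (Var 2) (Var 0) (Var 1)) in
  add_var (add_var G1 Y) transport_spec.

(** With the transport operation kept as a variable, the verification involves only its
    specification and small terms. *)
Definition evid_equiv_of_transport (i j : nat) : tm :=
  Pi (U i)
  (Pi (Arrow (Var 0) (U j))
  (Pi (Var 1)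
  (Pi (Arrow (App (Var 1) (Var 0)) (RepMaps (Var 2) (Var 0) (Var 1)))
  (Arrow transport_spec
  (isEquiv (RepMaps (Var 3) (Var 1) (Var 2)) (App (Var 2) (Var 1))
           (evid (Var 1))))))).

(* s |-> f (min t s), with s = IVar 0 and t = IVar 1. *)
Definition connection (f : tm) : tm :=
  ELam 1 (RecOr (TLe (IVar 0) (IVar 1)) (TLe (IVar 1) (IVar 0))
                (EApp f [:: IVar 0]) (EApp f [:: IVar 1])).

(** No [iwk] is inserted: [phi] and [f] will be variables, which interval weakening fixes. *)
Definition naturality_dhom (phi f : tm) : tm :=
  ELam 1 (App (App phi (EApp f [:: IVar 0])) (connection f)).

(* The head is [evid]: in the contexts below, C and A come just before a. *)
Ltac lam_type t ::=
  let t' := eval lazy in t in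
  lazymatch t' with
  | Lam (App (App (Var 0) (Var ?k)) _) =>
    constr:(Arrow (RepMaps (Var k.+1) (Var k.-1) (Var k)) (App (Var k) (Var k.-1)))
  end.

Ltac extend h h' T :=
  lazymatch type of h with
  | ctx_ok ?G => have h' : ctx_ok (add_var G T) by eapply ok_var; tc
  end.

Ltac beta A := eapply (@cv_beta_ok _ A); [tc | tc | tc | nf | nf].

(** For fixed t, the connection runs from f 0 = a to f t. At t = 0 it is constant at a, hence the
    identity arrow; at t = 1 the minimum is s and eta gives f. *)
Lemma naturality_dhom_ty G i j
    (G' := add_var (add_var (add_var (transport_ctx G i j)
             (RepMaps (Var 4) (Var 2) (Var 3))) (Var 5))
             (Hom (Var 6) (Var 4) (Var 0))) :
  ctx_ok G' ->
  G' ⊢ naturality_dhom (Var 2) (Var 0) ∈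
    DHom (Var 6) (Var 0) (App (App (Var 2) (Var 5)) (idarr (Var 5)))
         (App (App (Var 2) (Var 1)) (Var 0)).
Proof. rewrite /G' /DHom => hG'; tc. Qed.

Lemma transport_evid_eq G i j
    (G' := add_var (transport_ctx G i j) (RepMaps (Var 4) (Var 2) (Var 3))) :
  ctx_ok G' ->
  exists e, G' ⊢ e ∈ Id (RepMaps (Var 5) (Var 3) (Var 4))
    (App (Var 2) (App (App (Var 0) (Var 3)) (idarr (Var 3)))) (Var 0).
Proof.
rewrite /G' => hG'.
eapply funext_intro; last move=> hz; try tc.
eapply funext_intro; last move=> hf; try tc.
(* The specification at u = phi a id_a, z, f and v = phi z f. *)
exists (App (App (App (App (App (Var 3)
  (App (App (Var 2) (Var 5)) (idarr (Var 5)))) (Var 1)) (Var 0))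
  (App (App (Var 2) (Var 1)) (Var 0))) (naturality_dhom (Var 2) (Var 0))).
by eapply ty_eq; [eapply ty_App; [tc | apply: naturality_dhom_ty; exact: hf] | nf].
Qed.

Lemma transport_evid_id G i j (X := RepMaps (Var 4) (Var 2) (Var 3)) :
  ctx_ok (transport_ctx G i j) ->
  exists e, transport_ctx G i j ⊢ e ∈
    Id (Arrow X X) (Defs.comp (Var 1) (evid (Var 2))) Defs.idfun.
Proof.
rewrite /X => hG'; pose Y := RepMaps (Var 5) (Var 3) (Var 4).
eapply funext_intro; last move=> hphi; try tc.
(* These heads are abstractions other than [evid], so their domain is given explicitly. *)
1,2: by move=> ?; eapply ty_eq; [apply: (@ty_App _ Y (wk 1 Y)); tc | nf].
have [e he] := transport_evid_eq hphi.
exists e; apply: ty_conv he _; apply: cv_Id; first by apply: cv_refl; tc.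
  apply: cv_sym; apply: (@cv_trans _ _ (App (Var 2) (App (evid (Var 3)) (Var 0)))).
    beta Y.
  eapply cv_eq; [eapply (@cv_App _ _ _ (Var 2) (Var 2)
    (App (evid (Var 3)) (Var 0)) (App (App (Var 0) (Var 3)) (idarr (Var 3))));
    [by apply: cv_refl; tc | beta Y] | nf | nf | nf].
apply: cv_sym; beta Y.
Qed.

Lemma evid_transport_id G i j (X := App (Var 3) (Var 2)) :
  ctx_ok (transport_ctx G i j) ->
  exists e, transport_ctx G i j ⊢ e ∈
    Id (Arrow X X) (Defs.comp (evid (Var 2)) (Var 1)) Defs.idfun.
Proof.
rewrite /X => hG'; pose Y := App (Var 4) (Var 3).
eapply funext_intro; last move=> hu; try tc.
1,2: by move=> ?; eapply ty_eq; [apply: (@ty_App _ Y (wk 1 Y)); tc | nf].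
(* The constant section at u is an arrow over id_a because C (id_a t) computes to C a. *)
exists (App (App (App (App (App (Var 1) (Var 0)) (Var 3)) (idarr (Var 3))) (Var 0))
  (ELam 1 (Var 0))).
apply: (ty_conv (A := Id Y
  (App (App (App (Var 2) (Var 0)) (Var 3)) (idarr (Var 3))) (Var 0))); first tc.
apply: cv_Id; first by apply: cv_refl; tc.
  apply: cv_sym; apply: (@cv_trans _ _ (App (evid (Var 3)) (App (Var 2) (Var 0)))).
    beta Y.
  beta (RepMaps (Var 5) (Var 3) (Var 4)).
apply: cv_sym; beta Y.
Qed.

(** The context is arbitrary so that the result is available in [yoneda_ctx] without weakening. *)
Lemma evid_equiv_of_transport_inhab G i j :
  ctx_ok G -> exists e, G ⊢ e ∈ evid_equiv_of_transport i j.
Proof.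
move=> hG.
have h1 : ctx_ok (add_var G (U i)) by apply: ok_var; apply: ty_U.
extend h1 h2 (Arrow (Var 0) (U j)).
extend h2 h3 (Var 1).
extend h3 h4 (Arrow (App (Var 1) (Var 0)) (RepMaps (Var 2) (Var 0) (Var 1))).
have h5 : ctx_ok (transport_ctx G i j) by eapply ok_var; tc.
have [e1 he1] := transport_evid_id h5.
have [e2 he2] := evid_transport_id h5.
exists (Lam (Lam (Lam (Lam (Lam (Pair (Pair (Var 1) e1) (Pair (Var 1) e2))))))).
do 5 apply: ty_Lam; rewrite -/transport_ctx.
eapply ty_Pair_ok; [tc | tc | |].
- by eapply ty_Pair_ok; [tc | tc | tc | exact: he1].
- by eapply ty_Pair_ok; [tc | tc | tc | exact: he2].
Qed.

(** * Transport from covariance *)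

(* The indices are A = 4, C = 2, a = 0, and 3, 1 for the two hypotheses. *)
Definition yoneda_ctx (G : ctx) (i j : nat) : ctx :=
  add_var (add_var (add_var (add_var (add_var G (U i)) (isSegal (Var 0)))
    (Arrow (Var 1) (U j))) (isCovariant (Var 2) (Var 0))) (Var 3).

(** The endpoint of the centre of contraction of the lifts of [f] starting at [u]. *)
Definition transport (cov a z f u : tm) : tm :=
  Fst (Fst (App (App (App (App cov a) z) f) u)).

Definition yoneda_inv : tm :=
  Lam (Lam (Lam (transport (Var 4) (Var 3) (Var 1) (Var 0) (Var 2)))).

(** Contractibility identifies the centre with the pair of v and the given arrow; [J] carries this
    along the first projection. *)
Lemma yoneda_inv_spec G i j :
  ctx_ok (yoneda_ctx G i j) ->
  exists e, yoneda_ctx G i j ⊢ e ∈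
    Pi (App (Var 2) (Var 0))
    (Pi (Var 5)
    (Pi (Hom (Var 6) (Var 2) (Var 0))
    (Pi (App (Var 5) (Var 1))
    (Pi (DHom (Var 6) (Var 1) (Var 3) (Var 0))
    (Id (App (Var 7) (Var 3))
        (App (App (App (wk 5 yoneda_inv) (Var 4)) (Var 3)) (Var 2)) (Var 1)))))).
Proof.
move=> h0.
extend h0 h1 (App (Var 2) (Var 0)).
extend h1 h2 (Var 5).
extend h2 h3 (Hom (Var 6) (Var 2) (Var 0)).
extend h3 h4 (App (Var 5) (Var 1)).
extend h4 h5 (DHom (Var 6) (Var 1) (Var 3) (Var 0)).
extend h5 h6 (App (Var 7) (Var 3)).
pose w := App (App (App (App (Var 6) (Var 5)) (Var 3)) (Var 2)) (Var 4).
exists (Lam (Lam (Lam (Lam (Lam (J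
  (Id (App (Var 9) (Var 5)) (Fst (wk 2 (Fst w))) (Fst (Var 1)))
  (Refl (Fst (Fst w))) (App (Snd w) (Pair (Var 1) (Var 0))))))))).
do 5 apply: ty_Lam.
pose D := DHom (Var 8) (Var 3) (Var 5) (Var 0).
apply: (ty_conv (A := Id (App (Var 7) (Var 3)) (Fst (Fst w))
                         (Fst (Pair (Var 1) (Var 0))))).
  by eapply (@ty_J_ok _ (Sig (App (Var 7) (Var 3)) D) (Fst w) _ _
    (Pair (Var 1) (Var 0))); first [tc | nf].
apply: cv_Id; last 1 first.
- by eapply (@cv_Sig_beta1 _ _ D); tc.
- by apply: cv_refl; tc.
pose H := Hom (Var 9) (Var 5) (Var 3); pose Cz := App (Var 8) (Var 4).
pose yu := App (wk 5 yoneda_inv) (Var 4).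
pose yu' := Lam (Lam (transport (Var 8) (Var 7) (Var 1) (Var 0) (Var 6))).
pose yuz := Lam (transport (Var 7) (Var 6) (Var 4) (Var 0) (Var 5)).
pose B := Arrow (Hom (Var 10) (Var 6) (Var 0)) (App (Var 8) (Var 0)).
(* Three beta steps, for u, z and f in turn, reduce the applied inverse to [Fst (Fst w)]. *)
apply: cv_sym; eapply (@cv_trans _ _ (App (App yu' (Var 3)) (Var 2))).
  eapply cv_eq; [eapply (@cv_App _ H Cz (App yu (Var 3)) (App yu' (Var 3))
    (Var 2) (Var 2)); [| by apply: cv_refl; tc] | nf | nf | nf].
  eapply cv_eq; [eapply (@cv_App _ (Var 9) B yu yu' (Var 3) (Var 3));
    [| by apply: cv_refl; tc] | nf | nf | nf].
  eapply (@cv_beta_ok _ (App (Var 7) (Var 5)) (RepMaps (Var 10) (Var 6) (Var 8)));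
    [tc | tc | tc | nf | nf].
eapply (@cv_trans _ _ (App yuz (Var 2))).
  eapply cv_eq; [eapply (@cv_App _ H Cz (App yu' (Var 3)) yuz (Var 2) (Var 2));
    [| by apply: cv_refl; tc] | nf | nf | nf].
  eapply (@cv_beta_ok _ (Var 9) B); [tc | tc | tc | nf | nf].
beta H.
Qed.

(* The bound variables are A : U_i, C : A -> U_j and a : A, in this order. *)
Theorem theorem5p1 (i j : nat) :
  exists e : tm,
    empty_ctx ⊢ e ∈
      Pi (U i)
      (Arrow (isSegal (Var 0))
      (Pi (Arrow (Var 0) (U j))
      (Arrow (isCovariant (Var 1) (Var 0))
      (Pi (Var 1)
      (isEquiv (RepMaps (Var 2) (Var 0) (Var 1))
               (App (Var 1) (Var 0))
               (evid (Var 0))))))).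
Proof.
have h1 : ctx_ok (add_var empty_ctx (U i)).
  by apply/ok_var/ty_U/ok_empty.
extend h1 h2 (isSegal (Var 0)).
extend h2 h3 (Arrow (Var 1) (U j)).
extend h3 h4 (isCovariant (Var 2) (Var 0)).
have h5 : ctx_ok (yoneda_ctx empty_ctx i j) by eapply ok_var; tc.
have [k hk] := evid_equiv_of_transport_inhab i j h5.
have [u hu] := yoneda_inv_spec h5.
have hy : yoneda_ctx empty_ctx i j ⊢ yoneda_inv ∈
    Arrow (App (Var 2) (Var 0)) (RepMaps (Var 4) (Var 0) (Var 2)) by tc.
have hA := ty_App hk (ty_var_at (k := 4) h5 isT erefl).
have hC := ty_App hA (ty_var_at (k := 2) h5 isT erefl).
have ha := ty_App hC (ty_var_at (k := 0) h5 isT erefl).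
exists (Lam (Lam (Lam (Lam (Lam
  (App (App (App (App (App k (Var 4)) (Var 2)) (Var 0)) yoneda_inv) u)))))).
by do 5 apply: ty_Lam; exact: ty_App (ty_App ha hy) hu.
Qed.
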